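(* Let $\Omega\subset\mathbb{R}^d$, $d\in\{2,3\}$, be an open connected bounded domain with smooth boundary, and let $\epsilon>0$. Let $(c_1,c_2,\Phi,u)$ be a smooth solution of the Nernst-Planck-Navier-Stokes system with Dirichlet boundary conditions for the concentrations, $$c_i|_{\partial\Omega}=\gamma_i,\qquad i=1,2,$$ where $\gamma_i=\gamma_i(x)$ are positive smooth time-independent functions on $\partial\Omega$, and assume that the initial data and boundary conditions are smooth. Then the ionic concentrations obey the uniform in time bounds $$c_i(x,t)\le\Gamma=\max\left\{\sup_{\partial\Omega}\gamma_1,\ \sup_{\partial\Omega}\gamma_2,\ \sup_\Omega c_1(0),\ \sup_\Omega c_2(0)\right\},\qquad i=1,2,$$ for all $x\in\Omega$ and all times $t\ge0$ at which the solution is defined.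
   Context: The Nernst-Planck-Navier-Stokes (NPNS) system for two ionic species with valences $z_1=1$, $z_2=-1$, with parameter $\epsilon>0$, is $$\partial_tc_i+u\cdot\nabla c_i=D_i\operatorname{div}(\nabla c_i+z_ic_i\nabla\Phi),\quad i=1,2,$$ $$-\epsilon\Delta\Phi=\rho,\qquad \rho=c_1-c_2,$$ $$\partial_tu+u\cdot\nabla u-\nu\Delta u+\nabla p=-\kappa\rho\nabla\Phi,\qquad \nabla\cdot u=0,$$ in $\Omega$ for $t>0$, with constants $D_1,D_2,\nu,\kappa>0$ ($D_1\ne D_2$ is allowed). The boundary conditions for $\Phi$ and $u$ are $\Phi(x,t)|_{\partial\Omega}=W(x)$, where $W$ is a given smooth time-independent function on $\partial\Omega$, and $u|_{\partial\Omega}=0$. $c_i(0)$ denotes the initial value $c_i(\cdot,0)$. *)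

(* Defs.v *)
From mathcomp Require Import all_boot all_order all_algebra.
From mathcomp Require Import all_classical all_reals all_analysis.
Import Order.TTheory GRing.Theory Num.Theory numFieldNormedType.Exports.

Set Implicit Arguments.
Unset Strict Implicit.
Unset Printing Implicit Defensive.

Local Open Scope classical_set_scope.
Local Open Scope ring_scope.

Section Smoothness.
Context {R : realType} {V W : normedModType R}.

(* C^oo on an open set, for V finite-dimensional: all iterated directional
   derivatives exist and are differentiable.  Nothing is required of f outside
   U, since for U open these derivatives at points of U only depend on f on U. *)
Definition smooth_on_open (U : set V) (f : V -> W) : Prop :=
  forall (s : seq V) (x : V), U x ->
    differentiable (foldr (fun v g => 'D_v g) f s) x.

(* Smoothness on an arbitrary set A (a closed domain, a boundary, a space-time
   cylinder with its initial slice): near each point of A, f agrees on A with a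
   function that is smooth on a full neighbourhood of that point. *)
Definition smooth_on (A : set V) (f : V -> W) : Prop :=
  forall x : V, A x -> exists U : set V, exists g : V -> W,
    [/\ open U, U x, smooth_on_open U g & {in A `&` U, f =1 g}].

End Smoothness.

Definition boundary {T : topologicalType} (A : set T) : set T :=
  closure A `\` interior A.

Section Operators.
Context {R : realType} {d : nat}.

(* The norm of 'rV[R]_d in the library is the max norm; only the topology it
   induces is used here. *)
Definition grad (f : 'rV[R]_d -> R) (x : 'rV[R]_d) : 'rV[R]_d :=
  \row_j 'D_(delta_mx 0 j) f x.

Definition divergence (F : 'rV[R]_d -> 'rV[R]_d) (x : 'rV[R]_d) : R :=
  \sum_j 'D_(delta_mx 0 j) (fun y => F y 0 j) x.

Definition laplacian (f : 'rV[R]_d -> R) : 'rV[R]_d -> R :=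
  divergence (grad f).

Definition dot (v w : 'rV[R]_d) : R := \sum_j v 0 j * w 0 j.

(* Smooth boundary: near each boundary point, the set is the strict sublevel
   set of a smooth function with nonvanishing gradient at that point (so the
   set lies locally on one side of its boundary). *)
Definition has_smooth_boundary (Omega : set 'rV[R]_d) : Prop :=
  forall p : 'rV[R]_d, boundary Omega p ->
    exists U : set 'rV[R]_d, exists phi : 'rV[R]_d -> R,
      [/\ open U, U p, smooth_on_open U phi, grad phi p != 0 &
          Omega `&` U = [set x | phi x < 0] `&` U].

Record smooth_bounded_domain (Omega : set 'rV[R]_d) : Prop := {
  domain_nonempty : Omega !=set0;
  domain_open : open Omega;
  domain_connected : connected Omega;
  domain_bounded : bounded_set Omega;
  domain_smooth : has_smooth_boundary Omega
}.

End Operators.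

Section NPNS.
Context {R : realType} {d : nat}.
Implicit Types (Omega : set 'rV[R]_d) (J : set R).

(* The set of times at which a solution is defined: [0, T], [0, T[ or
   [0, +oo[ . *)
Record time_interval (J : set R) : Prop := {
  time_is_interval : is_interval J;
  time_initial : J 0;
  time_ge0 : forall t, J t -> 0 <= t
}.

(* Smoothness in (x, t) jointly, up to the lateral boundary and up to the
   endpoints of J that belong to J. *)
Definition smooth_in_space_time {W : normedModType R} Omega J
    (f : 'rV[R]_d -> R -> W) : Prop :=
  smooth_on (closure Omega `*` J) (fun z : 'rV[R]_d * R => f z.1 z.2).

(* Fields are functions of (x, t).  The equations below are required at x in
   Omega and t in the interior of J, hence at t > 0.  If J has a last time, the
   equation there follows by continuity of the (left) derivatives. *)

Definition nernst_planck (D z : R) Omega J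
    (c Phi : 'rV[R]_d -> R -> R) (u : 'rV[R]_d -> R -> 'rV[R]_d) : Prop :=
  forall x t, Omega x -> interior J t ->
    derive1 (c x) t + dot (u x t) (grad (c ^~ t) x) =
    D * divergence
          (fun y => grad (c ^~ t) y + (z * c y t) *: grad (Phi ^~ t) y) x.

Definition poisson (eps : R) Omega J
    (rho Phi : 'rV[R]_d -> R -> R) : Prop :=
  forall x t, Omega x -> interior J t ->
    - (eps * laplacian (Phi ^~ t) x) = rho x t.

Definition navier_stokes (nu kappa : R) Omega J
    (rho Phi p : 'rV[R]_d -> R -> R) (u : 'rV[R]_d -> R -> 'rV[R]_d) : Prop :=
  forall x t, Omega x -> interior J t ->
    (forall k : 'I_d,
       derive1 (fun s => u x s 0 k) t
       + dot (u x t) (grad (fun y => u y t 0 k) x)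
       - nu * laplacian (fun y => u y t 0 k) x
       + grad (p ^~ t) x 0 k
       = - (kappa * rho x t * grad (Phi ^~ t) x 0 k))
    /\ divergence (u ^~ t) x = 0.

(* Smooth solutions on Omega and the time interval J for the valences 1 and -1,
   with the boundary conditions on Phi and u; the conditions on the
   concentrations are not included. *)
Record smooth_npns_solution (eps D1 D2 nu kappa : R) Omega J
    (W : 'rV[R]_d -> R) (c1 c2 Phi : 'rV[R]_d -> R -> R)
    (u : 'rV[R]_d -> R -> 'rV[R]_d) : Prop := {
  npns_smooth_c1 : smooth_in_space_time Omega J c1;
  npns_smooth_c2 : smooth_in_space_time Omega J c2;
  npns_smooth_Phi : smooth_in_space_time Omega J Phi;
  npns_smooth_u : smooth_in_space_time Omega J u;
  npns_c1 : nernst_planck D1 1 Omega J c1 Phi u;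
  npns_c2 : nernst_planck D2 (-1) Omega J c2 Phi u;
  npns_Phi : poisson eps Omega J (fun x t => c1 x t - c2 x t) Phi;
  npns_u : exists2 p : 'rV[R]_d -> R -> R, smooth_in_space_time Omega J p &
    navier_stokes nu kappa Omega J (fun x t => c1 x t - c2 x t) Phi p u;
  npns_bc_Phi : forall x t, boundary Omega x -> J t -> Phi x t = W x;
  npns_bc_u : forall x t, boundary Omega x -> J t -> u x t = 0
}.

Definition dirichlet_bc Omega J (gamma : 'rV[R]_d -> R)
    (c : 'rV[R]_d -> R -> R) : Prop :=
  forall x t, boundary Omega x -> J t -> c x t = gamma x.

(* The suprema are real-valued: for a smooth solution on a bounded domain the
   sets involved are nonempty and bounded. *)
Definition Gamma Omega (gamma1 gamma2 : 'rV[R]_d -> R)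
    (c1 c2 : 'rV[R]_d -> R -> R) : R :=
  Num.max (Num.max (sup (gamma1 @` boundary Omega))
                   (sup (gamma2 @` boundary Omega)))
          (Num.max (sup ((c1 ^~ 0) @` Omega)) (sup ((c2 ^~ 0) @` Omega))).

End NPNS.

(* Main.v *)
Require Import Defs.
From mathcomp Require Import all_boot all_order all_algebra.
From mathcomp Require Import all_classical all_reals all_analysis.
Import Order.TTheory GRing.Theory Num.Theory numFieldNormedType.Exports.

(** The bound is a weak maximum principle for the larger of the two
    concentrations. With the Poisson equation, the ion equation for [c_i] reads

      d_t c_i + u . grad c_i
        = D_i (Lap c_i + z_i grad c_i . grad Phi - c_i (c_i - c_j) / eps),

    where [j] is the other species: the valences enter the zeroth-order term only
    through their square. At a spatial maximum of [c_i] the gradient terms vanish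
    and the Laplacian is nonpositive. If moreover [c_i >= c_j] and [c_i >= 0]
    there, the reaction term is nonpositive too, so [c_i] cannot be increasing.
    The condition [c_i >= 0] comes for free, since the points to be excluded are
    those where [c_i] exceeds [Gamma], and [Gamma >= 0].

    To turn this into a contradiction, [delta * t] is subtracted from both
    concentrations. On the compact set [closure Omega * [0, t0]] take maximum
    points of [c_1 - delta t] and [c_2 - delta t] and keep the larger of the two
    maxima; say it is that of [c_i], at [(x1, t1)]. Subtracting the same function
    of time from both species makes [c_i >= c_j] at [(x1, t1)]. If
    [c_i x1 t1 > Gamma], this point is neither on the lateral boundary nor at
    time 0, so by maximality from the left in time [d_t c_i >= delta > 0],
    whereas the equation gives [d_t c_i <= 0]. Hence
    [c_i <= Gamma + delta t0] for every [delta > 0]. The spatial statement is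
    [nernst_planck_max], the single-species argument is [drifted_max_le], and the
    coupling of the species is [concentrations_le].

    The equations hold only at interior times. A last time of existence is
    reached by continuity ([le_at_last_time]). *)

Local Open Scope classical_set_scope.
Local Open Scope ring_scope.

(** * Smoothness on an arbitrary set *)

Section SmoothOn.
Context {R : realType} {V W : normedModType R}.
Implicit Types (A B : set V) (f g : V -> W).

Lemma smooth_on_subset A B f : A `<=` B -> smooth_on B f -> smooth_on A f.
Proof.
move=> AB fB x /AB /fB [U [g [oU Ux gU fg]]]; exists U, g; split => // y.
by rewrite inE => -[/AB By Uy]; apply: fg; rewrite inE.
Qed.

Lemma smooth_on_open_derive (U : set V) g v :
  smooth_on_open U g -> smooth_on_open U ('D_v g).
Proof. by move=> gU s x Ux; have := gU (rcons s v) x Ux; rewrite foldr_rcons. Qed.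

(** On an open set a local smooth representative agrees with the function near
    each point, so that the derivatives agree as well. *)
Lemma smooth_on_derive A f v :
  open A -> smooth_on A f -> smooth_on A ('D_v f).
Proof.
move=> oA fA x Ax; have [U [g [oU Ux gU fg]]] := fA x Ax.
exists (A `&` U), ('D_v g); split; first exact: openI.
- by [].
- by move=> s y [_ Uy]; exact: (smooth_on_open_derive U g v gU s y Uy).
- move=> y; rewrite inE => -[_ AUy]; apply: near_eq_derive.
  have : nbhs y (A `&` U) by apply: open_nbhs_nbhs; split => //; exact: openI.
  by apply: filterS => z AUz; apply: fg; rewrite inE.
Qed.

Lemma smooth_on_derivable A f v x :
  open A -> smooth_on A f -> A x -> derivable f x v.
Proof.
move=> oA fA Ax; have [U [g [oU Ux gU fg]]] := fA x Ax.
have /near_eq_derivable : {near x, g =1 f}.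
  have : nbhs x (A `&` U) by apply: open_nbhs_nbhs; split => //; exact: openI.
  by apply: filterS => y AUy; apply/esym/fg; rewrite inE.
by apply; apply: diff_derivable; exact: (gU [::]).
Qed.

Lemma smooth_on_continuous A f : smooth_on A f -> {within A, continuous f}.
Proof.
move=> fA; apply/subspace_continuousP => x Ax.
have [U [g [oU Ux gU fg]]] := fA x Ax.
have fxg : f x = g x by apply: fg; rewrite inE.
have gx : g @ within A (nbhs x) --> g x.
  exact: cvg_within_filter (differentiable_continuous (gU [::] x Ux)).
rewrite -fxg in gx; apply: cvg_trans gx; apply: near_eq_cvg.
have Ux' : nbhs x U by exact: open_nbhs_nbhs.
by apply: filterS Ux' => y Uy Ay; apply/esym/fg; rewrite inE.
Qed.

End SmoothOn.

(** * Derivative tests at a maximum *)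

Section MaximumTests.
Context {R : realType} {V : normedModType R}.
Implicit Types (f : V -> R) (a v : V).

(** One-sided bounds on the growth of [f] along [v], for maxima at which only one
    side is accessible: a maximum at the final time of a cylinder is seen only
    from the left. *)
Lemma derive_le_right f a v (m : R) : derivable f a v ->
  (\forall h \near 0^'+, f (h *: v + a) <= f a + h * m) -> 'D_v f a <= m.
Proof.
move=> df le_f; have := cvg_dnbhs_at_right df; rewrite -/('D_v f a) => qD.
rewrite -(cvg_lim _ qD) //; apply: limr_le; first by apply/cvg_ex; eexists; exact: qD.
near=> h; have h0 : 0 < h by near: h; exact: nbhs_right_gt.
rewrite /= -[_ *: _]/(_ * _) ler_pdivrMl // lerBlDl.
by near: h; exact: le_f.
Unshelve. all: by end_near. Qed.

Lemma derive_ge_left f a v (m : R) : derivable f a v ->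
  (\forall h \near 0^'-, f (h *: v + a) <= f a + h * m) -> m <= 'D_v f a.
Proof.
move=> df le_f; have := cvg_dnbhs_at_left df; rewrite -/('D_v f a) => qD.
rewrite -(cvg_lim _ qD) //; apply: limr_ge; first by apply/cvg_ex; eexists; exact: qD.
near=> h; have h0 : h < 0 by near: h; exact: nbhs_left_lt.
rewrite /= -[_ *: _]/(_ * _) ler_ndivlMl // lerBlDl.
by near: h; exact: le_f.
Unshelve. all: by end_near. Qed.

Lemma near_line a v (P : set V) :
  nbhs a P -> \forall h \near (0 : R), P (h *: v + a).
Proof.
move=> Pa; have lin : (fun h : R => h *: v + a) @ 0 --> (0 : R) *: v + a.
  by apply: cvgD; [apply: cvgZr_tmp; exact: cvg_id | exact: cvg_cst].
by apply: lin; rewrite scale0r add0r.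
Qed.

Lemma derive_local_max f a v : derivable f a v ->
  (\forall x \near a, f x <= f a) -> 'D_v f a = 0.
Proof.
move=> df fmax; have fline := near_line _ v _ fmax.
apply/eqP; rewrite eq_le; apply/andP; split.
- apply: derive_le_right => //; apply: cvg_within; apply: filterS fline => h.
  by rewrite mulr0 addr0.
- apply: derive_ge_left => //; apply: cvg_within; apply: filterS fline => h.
  by rewrite mulr0 addr0.
Qed.

Lemma derive_along_line f a v (s : R) : derivable f (s *: v + a) v ->
  is_derive s 1 (fun h : R => f (h *: v + a)) ('D_v f (s *: v + a)).
Proof.
have quot_eq : (fun h : R => h^-1 *: (((fun k : R => f (k *: v + a)) \o shift s)
      (h *: 1) - f (s *: v + a))) =
    (fun h : R => h^-1 *: ((f \o shift (s *: v + a)) (h *: v) - f (s *: v + a))).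
  by apply/funext => h /=; rewrite scalerDl -[h *: 1]/(h * 1) mulr1 addrA.
by move=> df; apply: DeriveDef; rewrite /derivable /derive quot_eq.
Qed.

(** If the second derivative were positive, the vanishing first derivative would
    be positive shortly after [a] along [v], and by the mean value theorem [f]
    would exceed [f a] there. *)
Lemma derive2_local_max f a v :
  (\forall x \near a, derivable f x v) -> derivable ('D_v f) a v ->
  (\forall x \near a, f x <= f a) -> 'D_v ('D_v f) a <= 0.
Proof.
move=> df ddf fmax; rewrite leNgt; apply/negP => D2_gt0.
have D1_eq0 : 'D_v f a = 0 by exact: derive_local_max f a v (nbhs_singleton df) fmax.
have D1_gt0 : \forall h \near 0^'+, 0 < 'D_v f (h *: v + a).
  have := cvgr_gt _ (cvg_dnbhs_at_right ddf) 0 D2_gt0.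
  move=> q_gt0; near=> h; have h0 : 0 < h by near: h; exact: nbhs_right_gt.
  have : 0 < h^-1 *: ('D_v f (h *: v + a) - 'D_v f a) by near: h; exact: q_gt0.
  by rewrite D1_eq0 subr0 -[_ *: _]/(_ * _) pmulr_rgt0 // invr_gt0.
have [e /= e0 He] : \forall h \near (0 : R), [/\ derivable f (h *: v + a) v,
    f (h *: v + a) <= f a & 0 < h -> 0 < 'D_v f (h *: v + a)].
  near=> h; split.
  - by near: h; exact: near_line df.
  - by near: h; exact: near_line fmax.
  - by near: h; exact: D1_gt0.
(* Half the radius, so that the closed segment lies in the open ball. *)
have ball_e s : 0 <= s <= e / 2 -> ball_ (fun x : R => `|x|) 0 e s.
  move=> /andP[s0 se]; rewrite /= sub0r normrN ger0_norm // (le_lt_trans se) //.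
  by rewrite ltr_pdivrMr // ltr_pMr // ltr1n.
have e2 : 0 < e / 2 by rewrite divr_gt0.
have dfl s : 0 <= s <= e / 2 ->
    is_derive s 1 (fun h : R => f (h *: v + a)) ('D_v f (s *: v + a)).
  by move=> /ball_e/He[ds _ _]; exact: derive_along_line.
have dfl_oo s : s \in `]0, e / 2[ ->
    is_derive s 1 (fun h : R => f (h *: v + a)) ('D_v f (s *: v + a)).
  by rewrite in_itv /= => /andP[s0 se]; apply: dfl; rewrite !ltW.
have cfl : {within `[0, e / 2], continuous (fun h : R => f (h *: v + a))}.
  by apply: derivable_within_continuous => s; rewrite in_itv /= => /dfl [].
have [s] := MVT e2 dfl_oo cfl.
rewrite in_itv /= => /andP[s0 se]; rewrite scale0r add0r subr0.
have [_ _ /(_ s0) ds_gt0] : [/\ derivable f (s *: v + a) v,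
    f (s *: v + a) <= f a & 0 < s -> 0 < 'D_v f (s *: v + a)].
  by apply/He/ball_e; rewrite !ltW.
have [_ fe _] : [/\ derivable f ((e / 2) *: v + a) v,
    f ((e / 2) *: v + a) <= f a & 0 < e / 2 -> 0 < 'D_v f ((e / 2) *: v + a)].
  by apply/He/ball_e; rewrite ltW /=.
by move=> eq; move: fe; rewrite -subr_le0 eq leNgt mulr_gt0.
Unshelve. all: by end_near. Qed.

End MaximumTests.

(** * Slices of space-time functions *)

(** Smoothness is a property of functions on the product [V * R], whereas the
    equations differentiate in space or in time only. The growth rate of a slice
    is that of the joint function in the direction [(v, 0)] or [(0, 1)], which
    identifies the derivatives even where the limits do not exist. *)
Section Slices.
Context {R : realType} {V : normedModType R}.
Implicit Types (F : V * R -> R).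

Let space_quotE F x t (v : V) :
  (fun h : R => h^-1 *: (((fun y => F (y, t)) \o shift x) (h *: v) - F (x, t))) =
  (fun h : R => h^-1 *: ((F \o shift (x, t)) (h *: ((v, 0) : V * R)) - F (x, t))).
Proof.
apply/funext => h; congr (_ *: (F _ - _)).
by congr (_, _); rewrite /= scaler0 add0r.
Qed.

Lemma derive_space F x t (v : V) :
  'D_v (fun y => F (y, t)) x = 'D_((v, 0) : V * R) F (x, t).
Proof. by rewrite /derive space_quotE. Qed.

Lemma derivable_space F x t (v : V) :
  derivable F (x, t) ((v, 0) : V * R) -> derivable (fun y => F (y, t)) x v.
Proof. by rewrite /derivable space_quotE. Qed.

Let time_quotE F x t :
  (fun h : R => h^-1 *: (((fun s => F (x, s)) \o shift t) (h *: 1) - F (x, t))) =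
  (fun h : R => h^-1 *: ((F \o shift (x, t)) (h *: ((0, 1) : V * R)) - F (x, t))).
Proof.
apply/funext => h; congr (_ *: (F _ - _)).
by congr (_, _); rewrite /= scaler0 add0r.
Qed.

Lemma derivable_time F x t :
  derivable F (x, t) ((0, 1) : V * R) -> derivable (fun s => F (x, s)) t 1.
Proof. by rewrite /derivable time_quotE. Qed.

End Slices.

Lemma derive_addZM {R : realType} {V : normedModType R} (z : R)
    (f g h : V -> R) (x v : V) :
  derivable f x v -> derivable g x v -> derivable h x v ->
  'D_v (fun w => f w + z * (g w * h w)) x =
  'D_v f x + z * (g x * 'D_v h x + h x * 'D_v g x).
Proof.
move=> /derivableP df /derivableP dg /derivableP dh.
by have [] := is_deriveD df (is_deriveZ z (is_deriveM dg dh)).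
Qed.

(** * The Nernst-Planck equation at a maximum of the concentration *)

Section NernstPlanckMaximum.
Context {R : realType} {d : nat}.
Context (Omega : set 'rV[R]_d) (J : set R) (openOmega : open Omega).
Implicit Types (c Phi : 'rV[R]_d -> R -> R).

Let cyl := Omega `*` interior J.

Let open_cyl : open cyl.
Proof.
apply: openI; first by apply: open_comp => // w _; exact: cvg_fst.
by apply: open_comp; [move=> w _; exact: cvg_snd | exact: open_interior].
Qed.

Let smooth_cyl c : smooth_in_space_time Omega J c ->
  smooth_on cyl (fun w : 'rV[R]_d * R => c w.1 w.2).
Proof.
by apply: smooth_on_subset => w [/subset_closure ? /interior_subset ?].
Qed.

Lemma divergence_flux (z : R) c Phi x t :
  smooth_in_space_time Omega J c -> smooth_in_space_time Omega J Phi ->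
  Omega x -> interior J t ->
  divergence (fun y => grad (c ^~ t) y + (z * c y t) *: grad (Phi ^~ t) y) x =
  laplacian (c ^~ t) x + z * dot (grad (c ^~ t) x) (grad (Phi ^~ t) x)
    + z * c x t * laplacian (Phi ^~ t) x.
Proof.
move=> /smooth_cyl sC /smooth_cyl sP Ox Jt.
pose C (w : 'rV[R]_d * R) := c w.1 w.2; pose P (w : 'rV[R]_d * R) := Phi w.1 w.2.
have cyl_xt : cyl (x, t) by split.
rewrite /laplacian /divergence /dot !mulr_sumr -!big_split /=.
apply: eq_bigr => j _; set e := delta_mx 0 j.
pose v : 'rV[R]_d * R := (e, 0).
have gradE f y : grad (f ^~ t) y 0 j =
    'D_v (fun w : 'rV[R]_d * R => f w.1 w.2) (y, t).
  by rewrite mxE -derive_space.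
have dC : derivable C (x, t) v by exact: smooth_on_derivable sC cyl_xt.
have dDC : derivable ('D_v C) (x, t) v.
  exact: (smooth_on_derivable _ _ _ _ open_cyl (smooth_on_derive _ _ v open_cyl sC)).
have dDP : derivable ('D_v P) (x, t) v.
  exact: (smooth_on_derivable _ _ _ _ open_cyl (smooth_on_derive _ _ v open_cyl sP)).
have D2E f : 'D_e (fun y => grad (f ^~ t) y 0 j) x =
    'D_v ('D_v (fun w : 'rV[R]_d * R => f w.1 w.2)) (x, t).
  rewrite -derive_space; congr ('D_e _ x).
  by apply/funext => y; exact: gradE.
have -> : 'D_e (fun y => (grad (c ^~ t) y + (z * c y t) *: grad (Phi ^~ t) y) 0 j) x
    = 'D_v (fun w => 'D_v C w + z * (C w * 'D_v P w)) (x, t).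
  rewrite -derive_space; congr ('D_e _ x); apply/funext => y.
  by rewrite [LHS]mxE [X in _ + X]mxE !gradE mulrA.
rewrite (derive_addZM _ _ _ _ _ _ dDC dC dDP) !D2E !gradE mulrDr -!addrA.
by congr (_ + _); rewrite addrC ['D_v P _ * _]mulrC !mulrA.
Qed.

Lemma grad_laplacian_max c x t : smooth_in_space_time Omega J c ->
  Omega x -> interior J t -> (forall y, Omega y -> c y t <= c x t) ->
  grad (c ^~ t) x = 0 /\ laplacian (c ^~ t) x <= 0.
Proof.
move=> /smooth_cyl sC Ox Jt cmax.
have near_Omega : nbhs x Omega by exact: open_nbhs_nbhs.
have near_max : \forall y \near x, c y t <= c x t by exact: filterS near_Omega.
pose C (w : 'rV[R]_d * R) := c w.1 w.2.
have dC v y : Omega y -> derivable (c ^~ t) y v.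
  move=> Oy; apply: (derivable_space C).
  exact: (smooth_on_derivable cyl).
split.
  by apply/rowP => j; rewrite !mxE derive_local_max //; exact: dC.
rewrite /laplacian /divergence; apply: sumr_le0 => j _; set e := delta_mx 0 j.
have -> : (fun y => grad (c ^~ t) y 0 j) = 'D_e (c ^~ t).
  by apply/funext => y; rewrite mxE.
apply: derive2_local_max => //; first by apply: filterS near_Omega => y /dC.
have -> : 'D_e (c ^~ t) = (fun y => 'D_((e, 0) : 'rV[R]_d * R) C (y, t)).
  by apply/funext => y; rewrite -derive_space.
apply: (derivable_space ('D_((e, 0) : 'rV[R]_d * R) C)).
apply: (smooth_on_derivable cyl) => //.
exact: smooth_on_derive.
Qed.

(** After the gradient terms and the nonpositive Laplacian are dropped, only the
    reaction term created by the divergence of the drift flux remains. *)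
Lemma nernst_planck_max (D z : R) c Phi u x t : 0 <= D ->
  smooth_in_space_time Omega J c -> smooth_in_space_time Omega J Phi ->
  nernst_planck D z Omega J c Phi u ->
  Omega x -> interior J t -> (forall y, Omega y -> c y t <= c x t) ->
  derive1 (c x) t <= D * (z * c x t * laplacian (Phi ^~ t) x).
Proof.
move=> D0 sC sP np Ox Jt cmax.
have [grad0 lap_le0] := grad_laplacian_max _ _ _ sC Ox Jt cmax.
have dot0r (w : 'rV[R]_d) : dot w 0 = 0.
  by rewrite /dot big1 // => i _; rewrite mxE mulr0.
have dot0l (w : 'rV[R]_d) : dot 0 w = 0.
  by rewrite /dot big1 // => i _; rewrite mxE mul0r.
have := np x t Ox Jt; rewrite divergence_flux // grad0 dot0l dot0r mulr0 !addr0.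
by move=> ->; rewrite ler_wpM2l // gerDr.
Qed.

(** Were [c x1 t1 > G], the point [(x1, t1)] would lie in [Omega] at a positive
    time; maximality in time gives a time derivative at least [delta], and
    [nernst_planck_max] one at most 0. The sign of the reaction term is a
    premise because it depends on the other species. *)
Lemma drifted_max_le (D z : R) c Phi u (G delta t0 : R) x1 t1 : 0 <= D ->
  smooth_in_space_time Omega J c -> smooth_in_space_time Omega J Phi ->
  nernst_planck D z Omega J c Phi u -> `]0, t0] `<=` interior J ->
  (forall x, closure Omega x -> c x 0 <= G) ->
  (forall x t, boundary Omega x -> 0 <= t <= t0 -> c x t <= G) ->
  0 < delta -> closure Omega x1 -> 0 <= t1 <= t0 ->
  (forall x t, closure Omega x -> 0 <= t <= t0 ->
    c x t - delta * t <= c x1 t1 - delta * t1) ->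
  (Omega x1 -> G < c x1 t1 -> z * c x1 t1 * laplacian (Phi ^~ t1) x1 <= 0) ->
  c x1 t1 <= G.
Proof.
move=> D0 sC sP np J0t0 init lateral delta0 clx1 t1_itv cmax reaction.
have [//|G_lt] := leP (c x1 t1) G.
have /andP[t1_ge0 t1_le] := t1_itv.
have t1_gt0 : 0 < t1.
  rewrite lt_def t1_ge0 andbT; apply: contraTneq G_lt => ->.
  by rewrite -leNgt init.
have Ox1 : Omega x1.
  apply: contrapT => nOx1; move: G_lt; rewrite ltNge lateral //.
  by split => // /interior_subset.
have Jt1 : interior J t1 by apply: J0t0; rewrite /= in_itv /= t1_gt0.
have space_max y : Omega y -> c y t1 <= c x1 t1.
  by move=> /subset_closure cly; have := cmax y t1 cly t1_itv; rewrite lerD2r.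
have ct_le := nernst_planck_max _ _ _ _ _ _ _ D0 sC sP np Ox1 Jt1 space_max.
have dct : derivable (c x1) t1 1.
  apply: (derivable_time (fun w : 'rV[R]_d * R => c w.1 w.2)).
  by apply: (smooth_on_derivable cyl) => //; exact: smooth_cyl.
suff delta_le : delta <= 'D_1 (c x1) t1.
  have := lt_le_trans delta0 (le_trans delta_le _).
  rewrite -derive1E => /(_ _ ct_le); rewrite ltNge mulr_ge0_le0 //.
  exact: reaction.
(* The point may be at the final time t0, where only the left side is available. *)
apply: derive_ge_left => //; near=> h.
have h_lt0 : h < 0 by near: h; exact: nbhs_left_lt.
have h_gt : - t1 < h by near: h; apply: nbhs_left_gt; rewrite oppr_lt0.
rewrite -[h *: 1]/(h * 1) mulr1 (mulrC h).
have := cmax x1 (h + t1) clx1; rewrite -lerBlDr add0r (ltW h_gt) /=.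
have -> : h + t1 <= t0 by rewrite (le_trans _ t1_le) // gerDr ltW.
by move=> /(_ isT); rewrite mulrDr opprD addrA lerD2r lerBlDr.
Unshelve. all: by end_near. Qed.

End NernstPlanckMaximum.
(** * Comparison of the two concentrations *)

Section TwoSpecies.
Context {R : realType} {d : nat}.
Context (Omega : set 'rV[R]_d) (J : set R).
Context (openOmega : open Omega) (boundedOmega : bounded_set Omega).
Context (time_J : time_interval J).

Lemma compact_closure_bounded : compact (closure Omega).
Proof.
apply: bounded_closed_compact; last exact: closed_closure.
have : \forall M \near +oo, forall x, Omega x -> `|x| <= M by exact: boundedOmega.
apply: filterS => M le_M x clx.
have : closed_ball_ Num.norm (0 : 'rV[R]_d) M x.
  have /closure_id -> := @closed_closed_ball_ R 'rV[R]_d 0 M.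
  by apply: closureS clx => y /le_M; rewrite /closed_ball_ /= sub0r normrN.
by rewrite /closed_ball_ /= sub0r normrN.
Qed.

Lemma within_drift_continuous c (delta t0 : R) :
  smooth_in_space_time Omega J c -> `[0, t0] `<=` J ->
  {within closure Omega `*` `[0, t0],
    continuous (fun w : 'rV[R]_d * R => c w.1 w.2 - delta * w.2)}.
Proof.
move=> sC subJ.
have sCK : smooth_on (closure Omega `*` `[0, t0]) (fun w : 'rV[R]_d * R => c w.1 w.2).
  by apply: smooth_on_subset sC => w [? /subJ].
have /subspace_continuousP cC := smooth_on_continuous _ _ sCK.
apply/subspace_continuousP => w Kw; apply: cvgB; first exact: cC.
apply: cvg_within_filter; apply: cvgM; [exact: cvg_cst | exact: cvg_snd].
Qed.

(** The species whose drifted maximum is the larger one dominates the other at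
    its maximum point, and this is what makes its reaction term
    [- c_i (c_i - c_j) / eps] nonpositive. *)
Lemma concentrations_le (eps D1 D2 G t0 : R)
    (c1 c2 Phi : 'rV[R]_d -> R -> R) (u : 'rV[R]_d -> R -> 'rV[R]_d) :
  0 < eps -> 0 <= D1 -> 0 <= D2 -> 0 <= G ->
  smooth_in_space_time Omega J c1 -> smooth_in_space_time Omega J c2 ->
  smooth_in_space_time Omega J Phi ->
  nernst_planck D1 1 Omega J c1 Phi u ->
  nernst_planck D2 (-1) Omega J c2 Phi u ->
  poisson eps Omega J (fun x t => c1 x t - c2 x t) Phi ->
  (forall x, closure Omega x -> c1 x 0 <= G /\ c2 x 0 <= G) ->
  (forall x t, boundary Omega x -> J t -> c1 x t <= G /\ c2 x t <= G) ->
  interior J t0 -> forall x, Omega x -> c1 x t0 <= G /\ c2 x t0 <= G.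
Proof.
move=> eps0 D10 D20 G0 sC1 sC2 sP np1 np2 poi init lateral Jt0 x Ox.
have [itvJ J0 J_ge0] := time_J.
have t0_ge0 : 0 <= t0 by apply: J_ge0; exact: interior_subset Jt0.
have J0t0 : `[0, t0] `<=` J.
  by move=> s; rewrite /= in_itv /=; apply: itvJ => //; exact: interior_subset Jt0.
have J0t0_int : `]0, t0] `<=` interior J.
  move=> s; rewrite /= in_itv /= => /andP[s_gt0].
  rewrite le_eqVlt => /orP[/eqP->//|s_lt].
  have : nbhs s `]0, t0[%classic.
    apply: open_nbhs_nbhs; split; first exact: interval_open.
    by rewrite /= in_itv /= s_gt0.
  apply: filterS => r /=; rewrite in_itv /= => /andP[? ?].
  by apply: J0t0; rewrite /= in_itv /= !ltW.
have lat1 y s : boundary Omega y -> 0 <= s <= t0 -> c1 y s <= G.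
  by move=> By s_itv; apply: (lateral y s By _).1; apply: J0t0; rewrite /= in_itv.
have lat2 y s : boundary Omega y -> 0 <= s <= t0 -> c2 y s <= G.
  by move=> By s_itv; apply: (lateral y s By _).2; apply: J0t0; rewrite /= in_itv.
suff drift delta : 0 < delta ->
    c1 x t0 <= G + delta * t0 /\ c2 x t0 <= G + delta * t0.
  have le_of_drift (a : R) :
      (forall delta, 0 < delta -> a <= G + delta * t0) -> a <= G.
    move=> a_le; apply/ler_addgt0Pr => e e0.
    have t1_gt0 : 0 < t0 + 1 by rewrite ltr_wpDl.
    have := a_le (e / (t0 + 1)) (divr_gt0 e0 t1_gt0).
    move=> /le_trans; apply; rewrite lerD2l mulrAC ler_pdivrMr //.
    by rewrite ler_pM2l // lerDl.
  by split; apply: le_of_drift => delta /drift [].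
move=> delta0; pose K := closure Omega `*` `[0, t0]%classic.
have cK : compact K.
  by apply: compact_setX; [exact: compact_closure_bounded | exact: segment_compact].
have K0 : K !=set0.
  by exists (x, t0); split; [exact: subset_closure | rewrite /= in_itv /= t0_ge0 /=].
have [[x1 t1] + max1] := compact_EVT_max K0 cK
  (within_drift_continuous c1 delta t0 sC1 J0t0).
have [[x2 t2] + max2] := compact_EVT_max K0 cK
  (within_drift_continuous c2 delta t0 sC2 J0t0).
rewrite !inE => -[/= clx2]; rewrite in_itv /= => t2_itv.
move=> [/= clx1]; rewrite in_itv /= => t1_itv.
have {}max1 y s : closure Omega y -> 0 <= s <= t0 ->
    c1 y s - delta * s <= c1 x1 t1 - delta * t1.
  by move=> cly s_itv; apply: (max1 (y, s)); rewrite inE; split; rewrite //= in_itv.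
have {}max2 y s : closure Omega y -> 0 <= s <= t0 ->
    c2 y s - delta * s <= c2 x2 t2 - delta * t2.
  by move=> cly s_itv; apply: (max2 (y, s)); rewrite inE; split; rewrite //= in_itv.
have lapE y s : Omega y -> interior J s ->
    laplacian (Phi ^~ s) y = (c2 y s - c1 y s) / eps.
  move=> Oy Js; rewrite -(opprB (c1 y s)) -(poi y s Oy Js) opprK mulrC mulKf //.
  exact: lt0r_neq0.
have drift_nonneg s : 0 <= s <= t0 -> 0 <= delta * s.
  by move=> /andP[s0 _]; rewrite mulr_ge0 // ltW.
have t0_itv : 0 <= t0 <= t0 by rewrite t0_ge0 /=.
have clx : closure Omega x by exact: subset_closure.
suff M_le : c1 x1 t1 - delta * t1 <= G /\ c2 x2 t2 - delta * t2 <= G.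
  by rewrite -!lerBlDr; split; [apply: le_trans M_le.1; exact: max1
                               |apply: le_trans M_le.2; exact: max2].
have pos_time s y (c : 'rV[R]_d -> R -> R) :
    0 <= s <= t0 -> G < c y s -> c y 0 <= G -> interior J s.
  move=> /andP[s0 s_le] Glt G0le; apply: J0t0_int.
  rewrite /= in_itv /= s_le andbT lt_def s0 andbT.
  by apply: contraTneq Glt => ->; rewrite -leNgt.
have [M12|M21] := leP (c1 x1 t1 - delta * t1) (c2 x2 t2 - delta * t2).
- suff c2_le : c2 x2 t2 <= G.
    have M2 : c2 x2 t2 - delta * t2 <= G.
      by rewrite (le_trans _ c2_le) // gerBl drift_nonneg.
    by split => //; exact: le_trans M2.
  apply: (drifted_max_le _ _ openOmega D2 (-1) c2 Phi u G delta t0 x2 t2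
    D20 sC2 sP np2) => //.
    by move=> y /init[].
  move=> Ox2 Glt; rewrite lapE //; last by apply: pos_time Glt (init _ clx2).2.
  have c12 : c1 x2 t2 <= c2 x2 t2.
    by rewrite -(lerD2r (- (delta * t2))) (le_trans _ M12) // max1.
  rewrite mulN1r mulNr oppr_le0 mulr_ge0 //; first exact: le_trans (ltW Glt).
  by rewrite divr_ge0 // ?subr_ge0 // ltW.
- suff c1_le : c1 x1 t1 <= G.
    have M1 : c1 x1 t1 - delta * t1 <= G.
      by rewrite (le_trans _ c1_le) // gerBl drift_nonneg.
    by split => //; exact: le_trans (ltW M21) M1.
  apply: (drifted_max_le _ _ openOmega D1 1 c1 Phi u G delta t0 x1 t1
    D10 sC1 sP np1) => //.
    by move=> y /init[].
  move=> Ox1 Glt; rewrite lapE //; last by apply: pos_time Glt (init _ clx1).1.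
  have c21 : c2 x1 t1 <= c1 x1 t1.
    by rewrite -(lerD2r (- (delta * t1))) (le_trans _ (ltW M21)) // max2.
  rewrite mul1r mulr_ge0_le0 //; first exact: le_trans (ltW Glt).
  by rewrite mulr_le0_ge0 ?subr_le0 // invr_ge0 ltW.
Qed.

(** The equations, hence the comparison, are available only at interior times;
    a time [t] that is the last one of [J] is a limit of such times. *)
Lemma le_at_last_time (c : 'rV[R]_d -> R -> R) x t (G : R) :
  smooth_in_space_time Omega J c -> closure Omega x -> J t -> 0 < t ->
  (forall s, 0 < s < t -> c x s <= G) -> c x t <= G.
Proof.
move=> sC clx Jt t_gt0 c_le.
have near_before : \forall s \near t^'-, 0 < s < t.
  near=> s; apply/andP; split; near: s; first exact: nbhs_left_gt.
  exact: nbhs_left_lt.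
have pair_cvg : (fun s : R => (x, s)) @ t^'- --> nbhs (x, t).
  apply: (@cvg_pair _ _ _ _ (nbhs x) (nbhs t)); first exact: cvg_cst.
  exact: cvg_at_left_filter cvg_id.
have ct : c x s @[s --> t^'-] --> c x t.
  have /subspace_continuousP cC := smooth_on_continuous _ _ sC.
  have := cvg_comp (fun s : R => (x, s)) _ _ (cC (x, t) (conj clx Jt)).
  apply => P /pair_cvg; apply: filterS2 near_before => s /= /andP[s_gt0 s_lt].
  apply; split => //=; have [itvJ J0 _] := time_J.
  by apply: (itvJ 0 t) => //; rewrite !ltW.
rewrite -(cvg_lim _ ct) //.
apply: limr_le; first by apply/cvg_ex; eexists; exact: ct.
by apply: filterS near_before => s /c_le.
Unshelve. all: by end_near. Qed.

End TwoSpecies.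

(** * Comparison with Gamma *)

Lemma smooth_on_compact_bounded {R : realType} {V : normedModType R}
    (A : set V) (f : V -> R) :
  compact A -> smooth_on A f -> has_ubound (f @` A).
Proof.
move=> cA sf; have [->|/set0P A0] := eqVneq A set0.
  by rewrite image_set0; exists 0 => x [].
have [a _ fa] := compact_EVT_max A0 cA (smooth_on_continuous _ _ sf).
by exists (f a) => _ [x Ax <-]; apply: fa; rewrite inE.
Qed.

Theorem theorem7 (R : realType) (d : nat) (hd : d = 2%N \/ d = 3%N)
  (Omega : set 'rV[R]_d) (hOmega : smooth_bounded_domain Omega)
  (eps D1 D2 nu kappa : R)
  (heps : 0 < eps) (hD1 : 0 < D1) (hD2 : 0 < D2)
  (hnu : 0 < nu) (hkappa : 0 < kappa)
  (W gamma1 gamma2 : 'rV[R]_d -> R)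
  (hW : smooth_on (boundary Omega) W)
  (hgamma1 : smooth_on (boundary Omega) gamma1)
  (hgamma2 : smooth_on (boundary Omega) gamma2)
  (gamma1_gt0 : forall x, boundary Omega x -> 0 < gamma1 x)
  (gamma2_gt0 : forall x, boundary Omega x -> 0 < gamma2 x)
  (J : set R) (hJ : time_interval J)
  (c1 c2 Phi : 'rV[R]_d -> R -> R) (u : 'rV[R]_d -> R -> 'rV[R]_d)
  (hsol : smooth_npns_solution eps D1 D2 nu kappa Omega J W c1 c2 Phi u)
  (hc1 : dirichlet_bc Omega J gamma1 c1)
  (hc2 : dirichlet_bc Omega J gamma2 c2)
  (hc1_0 : smooth_on (closure Omega) (c1 ^~ 0))
  (hc2_0 : smooth_on (closure Omega) (c2 ^~ 0))
  (hu_0 : smooth_on (closure Omega) (u ^~ 0)) :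
  forall x t, Omega x -> J t ->
    c1 x t <= Gamma Omega gamma1 gamma2 c1 c2 /\
    c2 x t <= Gamma Omega gamma1 gamma2 c1 c2.
Proof.
move=> x t Ox Jt.
have [_ oO _ bO _] := hOmega.
have [itvJ J0 J_ge0] := hJ.
have [sC1 sC2 sP _ np1 np2 poi _ _ _] := hsol.
have bdcl y : boundary Omega y -> closure Omega y by case.
have cK := compact_closure_bounded _ bO.
set G := Gamma Omega gamma1 gamma2 c1 c2.
have ub1 := smooth_on_compact_bounded _ _ cK hc1_0.
have ub2 := smooth_on_compact_bounded _ _ cK hc2_0.
have ub_sub (A B : set 'rV[R]_d) (f : 'rV[R]_d -> R) : A `<=` B ->
    has_ubound (f @` B) -> has_ubound (f @` A).
  by move=> AB [M fM]; exists M => _ [y /AB By <-]; apply: fM; exists y.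
(* The data gamma_i are bounded because they are the traces of c_i at time 0. *)
have g1_le y : boundary Omega y -> gamma1 y <= G.
  move=> By; rewrite /G /Gamma !le_max; apply/orP; left; apply/orP; left.
  apply: ub_le_sup; last by exists y.
  have [M c1M] := ub1; exists M => _ [w Bw <-]; rewrite -(hc1 w 0 Bw J0).
  by apply: c1M; exists w => //; exact: bdcl.
have g2_le y : boundary Omega y -> gamma2 y <= G.
  move=> By; rewrite /G /Gamma !le_max; apply/orP; left; apply/orP; right.
  apply: ub_le_sup; last by exists y.
  have [M c2M] := ub2; exists M => _ [w Bw <-]; rewrite -(hc2 w 0 Bw J0).
  by apply: c2M; exists w => //; exact: bdcl.
have lateral y s : boundary Omega y -> J s -> c1 y s <= G /\ c2 y s <= G.
  by move=> By Js; rewrite hc1 // hc2 // g1_le // g2_le.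
have init y : closure Omega y -> c1 y 0 <= G /\ c2 y 0 <= G.
  move=> cly; have [Oy|nOy] := pselect (Omega y); last first.
    by apply: lateral => //; split => // /interior_subset.
  have sO := @subset_closure _ Omega.
  split; rewrite /G /Gamma !le_max; apply/orP; right; apply/orP.
  - by left; apply: ub_le_sup; [exact: ub_sub ub1 | exists y].
  - by right; apply: ub_le_sup; [exact: ub_sub ub2 | exists y].
(* The supremum of the empty set is 0 by convention. *)
have G_ge0 : 0 <= G.
  have [bd0|/set0P[y By]] := eqVneq (boundary Omega) set0.
    by rewrite /G /Gamma bd0 !image_set0 sup0 !le_max lexx.
  by rewrite (le_trans _ (g1_le y By)) // ltW // gamma1_gt0.
have interior_le s : interior J s -> c1 x s <= G /\ c2 x s <= G.
  move=> Js; exact: (concentrations_le Omega J oO bO hJ eps D1 D2 G s c1 c2 Phi u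
    heps (ltW hD1) (ltW hD2) G_ge0 sC1 sC2 sP np1 np2 poi init lateral Js).
have := J_ge0 t Jt; rewrite le_eqVlt => /orP[/eqP <-|t_gt0].
  by apply: init; exact: subset_closure.
have J0t s : 0 < s < t -> interior J s.
  move=> /andP[s0 st]; have : nbhs s `]0, t[%classic.
    by apply: open_nbhs_nbhs; split; [exact: interval_open | rewrite /= in_itv /= s0].
  apply: filterS => r /=; rewrite in_itv /= => /andP[? ?].
  by apply: (itvJ 0 t) => //; rewrite !ltW.
have clx : closure Omega x by exact: subset_closure.
by split; apply: (le_at_last_time Omega J hJ _ x t) => // s /J0t /interior_le [].
Qed.
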